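(* Let $H,F,G,P,w,d,\eta$ be the data of the barrier MPC problem described in the context, with $m$ constraints, and let $x_0$ be a state such that $\mathcal K(x_0)=\{u:Gu\le w+Px_0\}$ contains a ball of positive radius and is bounded. For $\sigma\in\{0,1\}^m$ define $$K_\sigma=H^{-1}[F^\top-G^\top(GH^{-1}G^\top)_\sigma^{-1}(GH^{-1}F^\top-P)]\quad\text{(whenever }\det([GH^{-1}G^\top]_\sigma)>0),$$ $$h_\sigma=\det([GH^{-1}G^\top]_\sigma)\prod_{i=1}^m(\eta^{-1}\phi_i^2)^{1-\sigma_i},\qquad\phi:=\phi(x_0,u^\eta(x_0))=Px_0+w-Gu^\eta(x_0),$$ and let $S:=\{\sigma\in\{0,1\}^m:\det([GH^{-1}G^\top]_\sigma)>0\}$. Then the derivative at $x_0$ of the barrier MPC solution map $u^\eta$ is $$\frac{\partial u^\eta}{\partial x_0}=\frac{1}{\sum_{\sigma\in S}h_\sigma}\sum_{\sigma\in S}h_\sigma K_\sigma.$$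
   Context: MPC data. Let $T\ge1$, $A\in\mathbb R^{d_x\times d_x}$, $B\in\mathbb R^{d_x\times d_u}$, and let $Q_1,\dots,Q_T$, $R_0,\dots,R_{T-1}$ be symmetric positive definite. The states $x_t$ and inputs $u_t$ of $x_{t+1}=Ax_t+Bu_t$ are constrained to compact polytopes; the constraints on the full sequences are $A_xx_{1:T}\le b_x$ and $A_uu_{0:T-1}\le b_u$, where $A_x,A_u$ are block diagonal with the per-step constraint matrices as blocks. Let $\widehat A=[A;A^2;\dots;A^T]$ (stacked vertically) and let $\widehat B$ be the block lower-triangular matrix with $(i,j)$ block $A^{i-j}B$ for $i\ge j$, so $x_{1:T}=\widehat Ax_0+\widehat Bu$ with $u=u_{0:T-1}\in\mathbb R^{Td_u}$. Put $H=R_{0:T-1}+\widehat B^\top Q_{1:T}\widehat B$ (block-diagonal $R_{0:T-1},Q_{1:T}$), $F=-2\widehat A^\top Q_{1:T}\widehat B$, $G=\begin{bmatrix} A_u \\ A_x\widehat B \end{bmatrix}\in\mathbb R^{m\times Td_u}$, $P=\begin{bmatrix} 0 \\ -A_x\widehat A \end{bmatrix}$, $w=\begin{bmatrix} b_u \\ b_x \end{bmatrix}$; $w$ is assumed entrywise positive. $H$ is symmetric positive definite. Barrier MPC with weight $\eta>0$: $\phi(x_0,u)=Px_0+w-Gu\in\mathbb R^m$, $d:=\nabla_u\sum_{i=1}^m\log\phi_i(0,u)|_{u=0}$, and $u^\eta(x_0)$ is the minimizer over $\{u:\phi(x_0,u)>0\}$ of $\tfrac12u^\top Hu-x_0^\top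 Fu-\eta\left[\sum_{i=1}^m\log\phi_i(x_0,u)-d^\top u\right]$. For $M\in\mathbb R^{m\times m}$ and $\sigma\in\{0,1\}^m$, $[M]_\sigma$ is the principal submatrix on indices with $\sigma_i=1$ (the determinant of the empty matrix is $1$), and $M_\sigma^{-1}$ is the $m\times m$ matrix obtained by inverting $[M]_\sigma$ and padding with zeros. *)

(* Defs.v *)
From HB Require Import structures.
From mathcomp Require Import all_boot all_order all_algebra.
From mathcomp Require Import all_classical all_reals all_analysis.

Set Implicit Arguments.
Unset Strict Implicit.
Unset Printing Implicit Defensive.

Import Order.TTheory GRing.Theory Num.Theory.
Import numFieldNormedType.Exports.
Local Open Scope classical_set_scope.
Local Open Scope ring_scope.

Definition posdefmx (R : realType) (n : nat) (M : 'M[R]_n) : Prop :=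
  M^T = M /\ forall v : 'cV[R]_n, v != 0 -> 0 < (v^T *m M *m v) 0 0.

Definition polyhedron (R : realType) (k n : nat) (C : 'M[R]_(k, n))
    (b : 'cV[R]_k) : set 'cV[R]_n :=
  [set x | forall i, (C *m x) i 0 <= b i 0].

(* Time is shifted to start at 0 for the state data: index t : 'I_T of mpc_Q,
   mpc_Cx, mpc_bx refers to x_(t+1), index t of mpc_R, mpc_Cu, mpc_bu to u_t.
   The number of constraint rows may depend on the step. *)
Record mpc (R : realType) (T dx du : nat) := Mpc {
  mpc_A : 'M[R]_dx;
  mpc_B : 'M[R]_(dx, du);
  mpc_Q : 'I_T -> 'M[R]_dx;
  mpc_R : 'I_T -> 'M[R]_du;
  mpc_mx : 'I_T -> nat;
  mpc_Cx : forall t, 'M[R]_(mpc_mx t, dx);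
  mpc_bx : forall t, 'cV[R]_(mpc_mx t);
  mpc_mu : 'I_T -> nat;
  mpc_Cu : forall t, 'M[R]_(mpc_mu t, du);
  mpc_bu : forall t, 'cV[R]_(mpc_mu t)
}.

Definition Xdim (T dx : nat) : nat := (\sum_(t < T) dx)%N.
Definition Udim (T du : nat) : nat := (\sum_(t < T) du)%N.

Definition Ahat R T dx du (D : mpc R T dx du) : 'M[R]_(Xdim T dx, dx) :=
  \mxcol_(t < T) (mpc_A D ^+ t.+1 : 'M[R]_dx).

Definition Bhat R T dx du (D : mpc R T dx du) :
    'M[R]_(Xdim T dx, Udim T du) :=
  \mxblock_(i < T, j < T)
    (if (j <= i)%N then (mpc_A D ^+ (i - j) : 'M[R]_dx) *m mpc_B D else 0).

Definition Qblk R T dx du (D : mpc R T dx du) : 'M[R]_(Xdim T dx) :=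
  \mxdiag_(t < T) mpc_Q D t.

Definition Rblk R T dx du (D : mpc R T dx du) : 'M[R]_(Udim T du) :=
  \mxdiag_(t < T) mpc_R D t.

Definition nconsx R T dx du (D : mpc R T dx du) : nat :=
  (\sum_(t < T) mpc_mx D t)%N.
Definition nconsu R T dx du (D : mpc R T dx du) : nat :=
  (\sum_(t < T) mpc_mu D t)%N.
Definition nconstr R T dx du (D : mpc R T dx du) : nat :=
  (nconsu D + nconsx D)%N.

(* Block diagonal with rectangular blocks, hence not \mxdiag. *)
Definition Axblk R T dx du (D : mpc R T dx du) :
    'M[R]_(nconsx D, Xdim T dx) :=
  \mxblock_(i < T, j < T) (if i == j then mpc_Cx D i else 0).

Definition Aublk R T dx du (D : mpc R T dx du) :
    'M[R]_(nconsu D, Udim T du) :=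
  \mxblock_(i < T, j < T) (if i == j then mpc_Cu D i else 0).

Definition mpcH R T dx du (D : mpc R T dx du) : 'M[R]_(Udim T du) :=
  Rblk D + (Bhat D)^T *m Qblk D *m Bhat D.

Definition mpcF R T dx du (D : mpc R T dx du) : 'M[R]_(dx, Udim T du) :=
  - 2 *: ((Ahat D)^T *m Qblk D *m Bhat D).

Definition mpcG R T dx du (D : mpc R T dx du) :
    'M[R]_(nconstr D, Udim T du) :=
  col_mx (Aublk D) (Axblk D *m Bhat D).

Definition mpcP R T dx du (D : mpc R T dx du) : 'M[R]_(nconstr D, dx) :=
  col_mx 0 (- (Axblk D *m Ahat D)).

Definition mpcw R T dx du (D : mpc R T dx du) : 'cV[R]_(nconstr D) :=
  col_mx (\mxcol_(t < T) mpc_bu D t) (\mxcol_(t < T) mpc_bx D t).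

Definition phi R T dx du (D : mpc R T dx du) (x : 'cV[R]_dx)
    (u : 'cV[R]_(Udim T du)) : 'cV[R]_(nconstr D) :=
  mpcP D *m x + mpcw D - mpcG D *m u.

Definition feasible R T dx du (D : mpc R T dx du) (x : 'cV[R]_dx) :
    set 'cV[R]_(Udim T du) :=
  [set u | forall i, (mpcG D *m u) i 0 <= (mpcw D + mpcP D *m x) i 0].

Definition strictly_feasible R T dx du (D : mpc R T dx du)
    (x : 'cV[R]_dx) : set 'cV[R]_(Udim T du) :=
  [set u | forall i, 0 < phi D x u i 0].

Definition log_barrier R T dx du (D : mpc R T dx du) (x : 'cV[R]_dx)
    (u : 'cV[R]_(Udim T du)) : R :=
  \sum_i ln (phi D x u i 0).

Definition gradient (R : realType) (n : nat) (f : 'cV[R]_n -> R)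
    (u : 'cV[R]_n) : 'cV[R]_n :=
  \col_j 'D_(delta_mx j 0) (f : 'cV[R]_n -> R^o) u.

Definition barrier_d R T dx du (D : mpc R T dx du) : 'cV[R]_(Udim T du) :=
  gradient (log_barrier D 0) 0.

Definition barrier_cost R T dx du (D : mpc R T dx du) (eta : R)
    (x : 'cV[R]_dx) (u : 'cV[R]_(Udim T du)) : R :=
  2^-1 * (u^T *m mpcH D *m u) 0 0 - (x^T *m mpcF D *m u) 0 0
  - eta * (log_barrier D x u - ((barrier_d D)^T *m u) 0 0).

Definition barrier_argmin R T dx du (D : mpc R T dx du) (eta : R)
    (x : 'cV[R]_dx) : set 'cV[R]_(Udim T du) :=
  [set u | strictly_feasible D x u /\
     forall v, strictly_feasible D x v ->
       barrier_cost D eta x u <= barrier_cost D eta x v].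

(* Takes the junk value 0 where there is no minimizer; the minimizer is
   unique when it exists (eta > 0 and H positive definite). *)
Definition u_eta R T dx du (D : mpc R T dx du) (eta : R)
    (x : 'cV[R]_dx) : 'cV[R]_(Udim T du) :=
  xget 0 (barrier_argmin D eta x).

Definition sigma_set (m : nat) (s : {ffun 'I_m -> bool}) : {set 'I_m} :=
  [set i | s i].

Definition prinsub (R : realType) (m : nat) (s : {ffun 'I_m -> bool})
    (M : 'M[R]_m) : 'M[R]_(#|sigma_set s|) :=
  mxsub (@enum_val _ (mem (sigma_set s))) (@enum_val _ (mem (sigma_set s))) M.

(* The rows of selmx s are the unit vectors e_i, i in sigma_set s, in increasing
   order, so that prinsub_inv s M has the entries of invmx (prinsub s M) at
   the positions in sigma_set s x sigma_set s and 0 elsewhere. *)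
Definition selmx (R : realType) (m : nat) (s : {ffun 'I_m -> bool}) :
    'M[R]_(#|sigma_set s|, m) :=
  rowsub (@enum_val _ (mem (sigma_set s))) 1%:M.

Definition prinsub_inv (R : realType) (m : nat) (s : {ffun 'I_m -> bool})
    (M : 'M[R]_m) : 'M[R]_m :=
  (selmx R s)^T *m invmx (prinsub s M) *m selmx R s.

Definition gram R T dx du (D : mpc R T dx du) : 'M[R]_(nconstr D) :=
  mpcG D *m invmx (mpcH D) *m (mpcG D)^T.

Definition Sset R T dx du (D : mpc R T dx du) :
    {set {ffun 'I_(nconstr D) -> bool}} :=
  [set s : {ffun 'I_(nconstr D) -> bool} | 0 < \det (prinsub s (gram D))].

(* Only meaningful for s in Sset D. *)
Definition K_sigma R T dx du (D : mpc R T dx du)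
    (s : {ffun 'I_(nconstr D) -> bool}) : 'M[R]_(Udim T du, dx) :=
  invmx (mpcH D) *m
    ((mpcF D)^T - (mpcG D)^T *m prinsub_inv s (gram D) *m
       (mpcG D *m invmx (mpcH D) *m (mpcF D)^T - mpcP D)).

Arguments K_sigma {R T dx du} D s.

Definition h_sigma R T dx du (D : mpc R T dx du) (eta : R) (x0 : 'cV[R]_dx)
    (s : {ffun 'I_(nconstr D) -> bool}) : R :=
  \det (prinsub s (gram D)) *
  \prod_i (eta^-1 * (phi D x0 (u_eta D eta x0) i 0) ^+ 2) ^+ (1 - s i)%N.

Arguments h_sigma {R T dx du} D eta x0 s.

(* Main.v *)
Require Import Defs.
From HB Require Import structures.
From mathcomp Require Import all_boot all_order all_algebra.
From mathcomp Require Import all_classical all_reals all_analysis.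
From mathcomp Require Import perm ring lra.

(* The barrier cost is strongly convex on the strictly feasible set, so its
   minimizer exists as soon as that set is nonempty, is a critical point, and
   lies within a constant times [|grad (x, v)|] of any strictly feasible [v];
   with [v = u_eta x0] this makes [u_eta] continuous at [x0].

   The critical point equations at [x] and [x0], subtracted, are an exact linear
   system for [du = u_eta x - u_eta x0] and [z_i = eta (1/phi_i - 1/phi0_i)]:
   [H du = F^T dx - G^T z] and [diag l z = G du - P dx], where
   [l_i = phi_i phi0_i / eta].
   Hence [du = H^-1 (F^T - G^T (diag l + M)^-1 (G H^-1 F^T - P)) dx] with
   [M = G H^-1 G^T], and continuity of the right-hand side in [l] gives the
   derivative at [x0].

   Finally [det (diag l + M)] is the sum over [s] of [det M_s] times the product
   of the [l_i], [i] outside [s]. Expanding likewise the determinant of a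
   rank-one perturbation of [diag l + M] in the direction of the row space of
   [G^T] expresses [G^T (diag l + M)^-1] as the claimed average of the
   [G^T M_s^-1]: the singular [M_s] contribute nothing, because a kernel vector
   of [M_s] is already annihilated by [G_s^T]. *)

Set Implicit Arguments.
Unset Strict Implicit.
Unset Printing Implicit Defensive.

Import Order.TTheory GRing.Theory Num.Theory.
Import numFieldNormedType.Exports.
Local Open Scope classical_set_scope.
Local Open Scope ring_scope.

(** * Principal minors *)

(** Sylvester's identity: one block matrix is factored into block triangular matrices in two
    ways. *)
Lemma det_1D_mulC (R : comNzRingType) (m n : nat) (A : 'M[R]_(m, n))
    (B : 'M[R]_(n, m)) :
  \det (1%:M + A *m B) = \det (1%:M + B *m A).
Proof.
have e1 : block_mx 1%:M 0 (- B) 1%:M *m block_mx 1%:M A 0 (1%:M + B *m A) =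
    block_mx 1%:M A (- B) 1%:M.
  rewrite mulmx_block !mul1mx ?mul0mx !mulmx1 ?mulmx0 !addr0 mulNmx.
  by rewrite addrCA addNr addr0.
have e2 : block_mx (1%:M + A *m B) A 0 1%:M *m block_mx 1%:M 0 (- B) 1%:M =
    block_mx 1%:M A (- B) 1%:M.
  by rewrite mulmx_block !mul1mx ?mul0mx !mulmx1 ?mulmx0 !add0r mulmxN addrK.
have := congr1 determinant (etrans e1 (esym e2)).
by rewrite !det_mulmx !det_lblock !det_ublock !det1 !mul1r !mulr1 => ->.
Qed.

(** Matrix determinant lemma: factoring out [N] leaves a perturbation of the identity, which the
    previous identity reduces to size one. *)
Lemma det_addmx_rank1 (R : comUnitRingType) (n : nat) (N : 'M[R]_n)
    (y : 'cV[R]_n) (c : 'rV[R]_n) : N \in unitmx ->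
  \det (N + y *m c) = \det N * (1 + (c *m invmx N *m y) 0 0).
Proof.
move=> Nu; have -> : N + y *m c = N *m (1%:M + invmx N *m y *m c).
  by rewrite mulmxDr mulmx1 !mulmxA mulmxV // mul1mx.
by rewrite det_mulmx det_1D_mulC det_mx11 mxE [X in X + _]mxE eqxx mulmxA.
Qed.

Section PrincipalMinors.
Variables (R : realType) (m : nat).
Implicit Types (s : {ffun 'I_m -> bool}) (M : 'M[R]_m).

Lemma selmx_mull s k (A : 'M[R]_(m, k)) :
  selmx R s *m A = rowsub (@enum_val _ (mem (sigma_set s))) A.
Proof. by rewrite mul_rowsub_mx mul1mx. Qed.

Lemma prinsubE s M : prinsub s M = selmx R s *m M *m (selmx R s)^T.
Proof.
apply/matrixP => i j; rewrite selmx_mull !mxE (bigD1 (enum_val j)) //= !mxE.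
rewrite eqxx mulr1 big1 ?addr0 // => k /negPf kj.
by rewrite !mxE eq_sym kj mulr0.
Qed.

Lemma selmx_mulT s : selmx R s *m (selmx R s)^T = 1%:M.
Proof.
rewrite -[selmx R s in X in X *m _]mulmx1 -prinsubE; apply/matrixP => i j.
by rewrite !mxE (inj_eq enum_val_inj).
Qed.

Lemma selmx_Tmul s :
  (selmx R s)^T *m selmx R s = diag_mx (\row_i (s i)%:R).
Proof.
apply/matrixP => i j; rewrite !mxE.
under eq_bigr do rewrite !mxE.
have [si|nsi] := boolP (s i).
  have iA : i \in sigma_set s by rewrite inE.
  rewrite (bigD1 (enum_rank_in iA i)) //= enum_rankK_in // eqxx mul1r big1.
    by rewrite addr0.
  move=> k kr; case: eqP => [e|_]; last by rewrite mul0r.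
  by case/eqP: kr; apply: enum_val_inj; rewrite enum_rankK_in.
rewrite mul0rn big1 // => k _; case: eqP => [e|_]; last by rewrite mul0r.
by have := enum_valP k; rewrite e inE (negPf nsi).
Qed.

(* The matrix on the left is [1 + E (M - 1)] with [E = S^T S] the coordinate
   projection and [S = selmx R s], [S S^T = 1]. *)
Lemma det_prinsub s M :
  \det (\matrix_(i, j) (if s i then M i j else (i == j)%:R)) =
  \det (prinsub s M).
Proof.
have -> : \matrix_(i, j) (if s i then M i j else (i == j)%:R) =
    1%:M + (selmx R s)^T *m (selmx R s *m (M - 1%:M)).
  rewrite mulmxA selmx_Tmul mul_diag_mx; apply/matrixP => i j; rewrite !mxE.
  by case: (s i); rewrite ?mul1r ?mul0r ?addr0 // addrC subrK.
rewrite det_1D_mulC mulmxBr mulmxBl mulmx1 selmx_mulT -prinsubE.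
by rewrite addrC subrK.
Qed.

(** Multilinearity in the rows: in the Leibniz formula each factor is a sum of two terms, and [s]
    records the rows where the entry of [M] is chosen. *)
Lemma det_diagD (l : 'rV[R]_m) M :
  \det (diag_mx l + M) =
  \sum_s \det (prinsub s M) * \prod_i l 0 i ^+ (1 - s i)%N.
Proof.
pose f := fun (p : {perm 'I_m}) i (b : bool) =>
  if b then M i (p i) else l 0 i *+ (i == p i).
have -> : \det (diag_mx l + M) =
    \sum_(p : {perm 'I_m}) (-1) ^+ p * \prod_i \sum_b f p i b.
  apply: eq_bigr => p _; congr (_ * _); apply: eq_bigr => i _.
  by rewrite !mxE big_bool /f addrC.
under eq_bigr do rewrite bigA_distr_bigA mulr_sumr.
rewrite exchange_big; apply: eq_bigr => s _ /=.
rewrite -det_prinsub.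
(* For fixed [s] the sum over [p] is the determinant of the matrix with the rows of [M] in [s] and
   multiples [l i] of unit rows outside; these multiples factor out as a diagonal matrix. *)
have -> : \prod_i l 0 i ^+ (1 - s i)%N =
    \det (diag_mx (\row_i l 0 i ^+ (1 - s i)%N)).
  by rewrite det_diag; apply: eq_bigr => i _; rewrite mxE.
rewrite mulrC -det_mulmx; apply: eq_bigr => p _; congr (_ * _).
apply: eq_bigr => i _; rewrite mul_diag_mx !mxE /f.
by case: (s i); rewrite ?mul1r // subn0 expr1 mulr_natr.
Qed.

End PrincipalMinors.

(** * Determinants and positive quadratic forms *)

Section QuadraticForms.
Variables (R : realType).

Lemma det_form_neq0 (n : nat) (M : 'M[R]_n) :
  (forall v : 'cV_n, v != 0 -> 0 < (v^T *m M *m v) 0 0) -> \det M != 0.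
Proof.
move=> M0; apply/negP => /det0P[v v0 vM].
have := M0 v^T; rewrite trmx_eq0 => /(_ v0).
by rewrite trmxK vM mul0mx mxE ltxx.
Qed.

(* The polynomial [det (1 + t (M - 1))] is 1 at [t = 0], [\det M] at [t = 1],
   and has no root in [0, 1[. *)
Lemma det_form_ge0 (n : nat) (M : 'M[R]_n) :
  (forall v : 'cV_n, 0 <= (v^T *m M *m v) 0 0) -> 0 <= \det M.
Proof.
move=> M0; pose q : {poly R} := \det (1%:M + 'X *: map_mx polyC (M - 1%:M)).
have qE t : q.[t] = \det (1%:M + t *: (M - 1%:M)).
  rewrite -[q.[t]]/(horner_eval t q) -det_map_mx; congr (\det _).
  apply/matrixP => i j; rewrite !mxE /= /horner_eval.
  by rewrite !(hornerMn, hornerE).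
rewrite leNgt; apply/negP => detM_lt0.
have q0 : (- q).[0] = -1 by rewrite hornerN qE scale0r addr0 det1.
have q1 : (- q).[1] = - \det M by rewrite hornerN qE scale1r addrC subrK.
have [] := @poly_ivt R (- q) 0 1 ler01.
  by rewrite q0 q1 oppr_ge0 (ltW detM_lt0) lerN10.
move=> t /andP[t0 t1]; rewrite /root hornerN qE oppr_eq0.
move: t1; rewrite le_eqVlt => /orP[/eqP->|t1].
  by rewrite scale1r addrC subrK => /eqP d0; rewrite d0 ltxx in detM_lt0.
apply/negP/det_form_neq0 => v v0.
(* The form is a convex combination of [v^T v] and the form of [M], with positive weight on the
   first since [t < 1]. *)
have -> : v^T *m (1%:M + t *: (M - 1%:M)) *m v =
    (1 - t) *: (v^T *m v) + t *: (v^T *m M *m v).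
  rewrite mulmxDr mulmx1 mulmxDl -scalemxAr -scalemxAl mulmxBr mulmx1 mulmxBl.
  by rewrite scalerBr scalerBl scale1r addrA addrAC.
rewrite mxE [X in X + _]mxE [X in _ + X]mxE.
apply: ltr_pwDl; last by rewrite mulr_ge0.
rewrite mulr_gt0 ?subr_gt0 //.
have [i vi] : exists i, v i 0 != 0.
  by apply/cV0Pn.
rewrite mxE (bigD1 i) //= ltr_pwDl //.
  by rewrite mxE -expr2 lt_def sqrf_eq0 vi sqr_ge0.
by apply: sumr_ge0 => j _; rewrite mxE -expr2 sqr_ge0.
Qed.

Lemma posdefmx_unit (n : nat) (H : 'M[R]_n) : posdefmx H -> H \in unitmx.
Proof. by move=> [_ H0]; rewrite unitmxE unitfE det_form_neq0. Qed.

Lemma posdefmx_inv (n : nat) (H : 'M[R]_n) : posdefmx H -> posdefmx (invmx H).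
Proof.
move=> Hpd; have Hu := posdefmx_unit Hpd; have [HT H0] := Hpd.
split=> [|v v0]; first by rewrite trmx_inv HT.
have -> : v^T *m invmx H *m v = (invmx H *m v)^T *m H *m (invmx H *m v).
  by rewrite trmx_mul trmx_inv HT !mulmxA mulmxKV.
apply: H0; apply/eqP => /(congr1 (mulmx H)); rewrite mulKVmx // mulmx0.
by apply/eqP.
Qed.

Lemma posdefmx_ge0 (n : nat) (H : 'M[R]_n) (v : 'cV[R]_n) : posdefmx H ->
  0 <= (v^T *m H *m v) 0 0.
Proof.
move=> [_ H0]; have [->|/H0/ltW//] := eqVneq v 0.
by rewrite mulmx0 mxE.
Qed.

End QuadraticForms.

(** * Principal minors of a Gram matrix and the averaged inverse *)

Section GramMatrix.
Variables (R : realType) (m n : nat) (K : 'M[R]_n) (G : 'M[R]_(m, n)).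
Hypothesis K_pd : posdefmx K.
Local Notation M := (G *m K *m G^T).
Implicit Types s : {ffun 'I_m -> bool}.

Let form_prinsub s (v : 'cV[R]_#|sigma_set s|) :
  v^T *m prinsub s M *m v =
  (G^T *m (selmx R s)^T *m v)^T *m K *m (G^T *m (selmx R s)^T *m v).
Proof. by rewrite prinsubE !trmx_mul !trmxK !mulmxA. Qed.

Lemma det_prinsub_gram_ge0 s : 0 <= \det (prinsub s M).
Proof.
by apply: det_form_ge0 => v; rewrite form_prinsub posdefmx_ge0.
Qed.

Lemma diagD_gram_form (l : 'rV[R]_m) (v : 'cV[R]_m) :
  (forall i, 0 < l 0 i) -> v != 0 -> 0 < (v^T *m (diag_mx l + M) *m v) 0 0.
Proof.
move=> l0 v0.
have -> : v^T *m (diag_mx l + M) *m v =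
    v^T *m diag_mx l *m v + (G^T *m v)^T *m K *m (G^T *m v).
  by rewrite mulmxDr mulmxDl trmx_mul trmxK !mulmxA.
rewrite mxE ltr_pwDl ?posdefmx_ge0 //.
have [i vi] : exists i, v i 0 != 0 by apply/cV0Pn.
have e j : (v^T *m diag_mx l) 0 j * v j 0 = l 0 j * v j 0 ^+ 2.
  by rewrite mul_mx_diag !mxE mulrAC mulrC -expr2.
rewrite mxE (bigD1 i) //= e ltr_pwDl //.
  by rewrite mulr_gt0 // lt_def sqrf_eq0 vi sqr_ge0.
by apply: sumr_ge0 => j _; rewrite e mulr_ge0 ?sqr_ge0 // ltW.
Qed.

Lemma diagD_gram_unit (l : 'rV[R]_m) :
  (forall i, 0 < l 0 i) -> diag_mx l + M \in unitmx.
Proof.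
move=> l0; rewrite unitmxE unitfE.
by apply: det_form_neq0 => v /diagD_gram_form ->.
Qed.

(* A kernel vector [v] of a singular [prinsub s M] satisfies [G^T S^T v = 0] by
   positivity of [K], and this also annihilates the rank-one perturbation. *)
Lemma det_prinsub_gramD_eq0 s (y : 'cV[R]_m) (a : 'rV[R]_n) :
  \det (prinsub s M) = 0 -> \det (prinsub s (M + y *m (a *m G^T))) = 0.
Proof.
move=> /eqP/det0P[v v0 vM].
have Gv0 : G^T *m (selmx R s)^T *m v^T = 0.
  apply/eqP/contraT => /(proj2 K_pd).
  by rewrite -form_prinsub trmxK vM mul0mx mxE ltxx.
(* The perturbation has [a *m G^T] as its right factor, so it kills [v^T] from the right; hence the
   passage to the transpose. *)
rewrite -det_tr; apply/eqP/det0P; exists v => //; apply: trmx_inj.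
rewrite trmx_mul trmxK trmx0 prinsubE !(mulmxDr, mulmxDl).
by rewrite -!mulmxA !(mulmxA G^T) Gv0 !mulmx0 addr0.
Qed.

(** This is [h_sigma] when [l i] is [eta^-1 * phi_i ^ 2]; a general [l] also covers the mixed
    products of slacks at two states. *)
Definition minor_weight (l : 'rV[R]_m) s : R :=
  \det (prinsub s M) * \prod_i l 0 i ^+ (1 - s i)%N.

(** All minors are nonnegative, so those left out of the sum are zero. *)
Lemma det_diagD_gram (l : 'rV[R]_m) :
  \det (diag_mx l + M) =
  \sum_(s | 0 < \det (prinsub s M)) minor_weight l s.
Proof.
rewrite det_diagD [LHS](bigID (fun s => 0 < \det (prinsub s M))) /=.
rewrite [X in _ + X]big1 ?addr0 // => s ns.
suff -> : \det (prinsub s M) = 0 by rewrite mul0r.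
by apply/eqP; rewrite eq_le det_prinsub_gram_ge0 leNgt ns.
Qed.

Lemma minor_weight_sum_gt0 (l : 'rV[R]_m) : (forall i, 0 < l 0 i) ->
  0 < \sum_(s | 0 < \det (prinsub s M)) minor_weight l s.
Proof.
move=> l0; rewrite -det_diagD_gram lt_def.
rewrite det_form_neq0 => [|v v0]; last exact: diagD_gram_form.
apply: det_form_ge0 => v; have [->|v0] := eqVneq v 0.
  by rewrite mulmx0 mxE.
exact/ltW/diagD_gram_form.
Qed.

(* With [N = diag_mx l + M], both sides of
   [\det (N + y c) = \det N (1 + c N^-1 y)], [c] in the row space of [G^T],
   are expanded into principal minors. *)
Lemma invmx_diagD_gram (l : 'rV[R]_m) : (forall i, 0 < l 0 i) ->
  (\sum_(s | 0 < \det (prinsub s M)) minor_weight l s) *: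
    (G^T *m invmx (diag_mx l + M)) =
  \sum_(s | 0 < \det (prinsub s M))
    minor_weight l s *: (G^T *m prinsub_inv s M).
Proof.
move=> l0; set S := fun s => 0 < \det (prinsub s M).
(* A matrix identity can be tested between a row [a] and a column [y]; unit vectors recover the
   entries. *)
suff key (a : 'rV_n) (y : 'cV_m) :
    (\sum_(s | S s) minor_weight l s) *
      (a *m G^T *m invmx (diag_mx l + M) *m y) 0 0 =
    \sum_(s | S s)
      minor_weight l s * (a *m G^T *m prinsub_inv s M *m y) 0 0.
  apply/matrixP => i j.
  have e (X : 'M[R]_(n, m)) :
      X i j = ((delta_mx 0 i : 'rV_n) *m X *m (delta_mx j 0 : 'cV_m)) 0 0.
    by rewrite -colE mxE -rowE mxE.
  rewrite [LHS]mxE summxE e !mulmxA key; apply: eq_bigr => s _.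
  by rewrite [RHS]mxE [X in _ = _ * X]e !mulmxA.
set c := a *m G^T; set N := diag_mx l + M.
have detE : \det (N + y *m c) =
    \sum_(s | S s) minor_weight l s * (1 + (c *m prinsub_inv s M *m y) 0 0).
  rewrite -addrA det_diagD (bigID S) /= [X in _ + X]big1 ?addr0.
    apply: eq_bigr => s Ss; rewrite /minor_weight mulrAC; congr (_ * _).
    have -> : prinsub s (M + y *m c) =
        prinsub s M + (selmx R s *m y) *m (c *m (selmx R s)^T).
      by rewrite !prinsubE mulmxDr mulmxDl !mulmxA.
    rewrite det_addmx_rank1 ?unitmxE ?unitfE ?gt_eqF //.
    by rewrite /prinsub_inv !mulmxA.
  move=> s nS; rewrite det_prinsub_gramD_eq0 ?mul0r //.
  by apply/eqP; rewrite eq_le det_prinsub_gram_ge0 leNgt nS.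
(* Both expansions contain the unperturbed determinant, the sum of the weights; cancelling it leaves
   the claim. *)
move: detE; rewrite det_addmx_rank1 ?diagD_gram_unit // det_diagD_gram -/S.
rewrite mulrDr mulr1; under [RHS]eq_bigr do rewrite mulrDr mulr1.
by rewrite big_split /= => /addrI.
Qed.

End GramMatrix.

(* [z] plays the role of the increment of the multipliers [eta / phi_i]. *)
Lemma kkt_solve (R : realType) (m n p : nat) (H : 'M[R]_n) (F : 'M[R]_(p, n))
    (G : 'M[R]_(m, n)) (P : 'M[R]_(m, p)) (l : 'rV[R]_m)
    (du : 'cV[R]_n) (dx : 'cV[R]_p) (z : 'cV[R]_m)
    (M := G *m invmx H *m G^T) :
  posdefmx H -> (forall i, 0 < l 0 i) ->
  H *m du = F^T *m dx - G^T *m z ->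
  diag_mx l *m z = G *m du - P *m dx ->
  du = ((\sum_(s | 0 < \det (prinsub s M)) minor_weight (invmx H) G l s)^-1 *:
    \sum_(s | 0 < \det (prinsub s M)) minor_weight (invmx H) G l s *:
      (invmx H *m (F^T - G^T *m prinsub_inv s M *m
         (G *m invmx H *m F^T - P)))) *m dx.
Proof.
move=> Hpd l0 stat compl.
have Hu := posdefmx_unit Hpd; have Kpd := posdefmx_inv Hpd.
have duE : du = invmx H *m (F^T *m dx - G^T *m z) by rewrite -stat mulKmx.
have zE : z = invmx (diag_mx l + M) *m ((G *m invmx H *m F^T - P) *m dx).
  (* Eliminating [du] between the two equations gives a linear system for [z] alone with matrix
     [diag_mx l + M]. *)
  rewrite -[LHS](mulKmx (diagD_gram_unit G Kpd l0)); congr (_ *m _).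
  rewrite [LHS]mulmxDl compl duE /M !(mulmxBr, mulmxBl) !mulmxA.
  by rewrite addrAC subrK.
set Sg := (X in X^-1 *: _).
have Sg0 : Sg != 0 by rewrite gt_eqF // minor_weight_sum_gt0.
apply: (scalerI Sg0); rewrite -scalemxAl scalerA divff // scale1r.
have -> : \sum_(s | 0 < \det (prinsub s M)) minor_weight (invmx H) G l s *:
      (invmx H *m (F^T - G^T *m prinsub_inv s M *m (G *m invmx H *m F^T - P))) =
    invmx H *m (Sg *: F^T - (\sum_(s | 0 < \det (prinsub s M))
      minor_weight (invmx H) G l s *: (G^T *m prinsub_inv s M)) *m
      (G *m invmx H *m F^T - P)).
  rewrite /Sg scaler_suml mulmx_suml -sumrB mulmx_sumr; apply: eq_bigr => s _.
  by rewrite -scalemxAl -scalerBr -scalemxAr.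
rewrite -invmx_diagD_gram // {1}duE zE -/Sg -scalemxAl -scalerBr.
by rewrite -scalemxAr -scalemxAl !(mulmxBr, mulmxBl, mulmxA).
Qed.

(** * Limits and derivatives of matrix-valued functions *)

Section MatrixLimits.
Variables (R : realType) (T : Type) (F : set_system T).
Context {FF : Filter F}.

Lemma cvg_coord m n (f : T -> 'M[R]_(m, n)) (A : 'M[R]_(m, n)) i j :
  f @ F --> A -> (fun t => f t i j) @ F --> A i j.
Proof.
move=> fA; apply: (@continuous_cvg _ _ _ F _ f (fun M => M i j) A) => //.
exact: coord_continuous.
Qed.

Lemma cvg_mx m n (f : T -> 'M[R]_(m, n)) (A : 'M[R]_(m, n)) :
  (forall i j, (fun t => f t i j) @ F --> A i j) -> f @ F --> A.
Proof.
move=> fA U [P nP sPU]; rewrite /nbhs /=.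
have : \forall t \near F, forall ij : 'I_m * 'I_n, P ij.1 ij.2 (f t ij.1 ij.2).
  by apply: filter_forall => -[i j] /=; apply: fA; exact: nP.
by apply: filterS => t Pt; apply: sPU => i j; exact: (Pt (i, j)).
Qed.

Lemma cvg_sumr (I : Type) (r : seq I) (P : pred I) (f : I -> T -> R)
    (a : I -> R) :
  (forall i, f i @ F --> a i) ->
  (fun t => \sum_(i <- r | P i) f i t) @ F --> \sum_(i <- r | P i) a i.
Proof.
by move=> fa; apply: cvg_big => [|i _]; [exact: add_continuous|exact: fa].
Qed.

Lemma cvg_mulmx m n p (f : T -> 'M[R]_(m, n)) (g : T -> 'M[R]_(n, p))
    (A : 'M[R]_(m, n)) (B : 'M[R]_(n, p)) :
  f @ F --> A -> g @ F --> B -> (fun t => f t *m g t) @ F --> A *m B.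
Proof.
move=> fA gB; apply: cvg_mx => i j; rewrite mxE.
rewrite (_ : (fun t => _) = fun t => \sum_k f t i k * g t k j); last first.
  by apply/funext => t; rewrite mxE.
apply: cvg_sumr => k.
by apply: cvgM; exact: cvg_coord.
Qed.

Lemma cvg_weighted_mean (I : Type) (r : seq I) (P : pred I) m n
    (w : T -> I -> R) (a : I -> R) (K : I -> 'M[R]_(m, n)) :
  (forall i, (fun t => w t i) @ F --> a i) -> \sum_(i <- r | P i) a i != 0 ->
  (fun t => (\sum_(i <- r | P i) w t i)^-1 *:
            \sum_(i <- r | P i) w t i *: K i) @ F -->
  (\sum_(i <- r | P i) a i)^-1 *: \sum_(i <- r | P i) a i *: K i.
Proof.
move=> wa a0; apply: cvg_mx => j k; rewrite mxE summxE.
under eq_fun do rewrite mxE summxE.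
apply: cvgM; first by apply: cvgV => //; exact: cvg_sumr.
apply: cvg_sumr => i; rewrite mxE; under eq_fun do rewrite mxE.
exact: cvgMr_tmp.
Qed.

End MatrixLimits.

(** * Norm bounds, compactness and differentiability *)

Lemma mx_norm_le (R : realType) m n (A : 'M[R]_(m, n)) (e : R) :
  0 <= e -> (forall i j, `|A i j| <= e) -> `|A| <= e.
Proof.
move=> e0 Ae; rewrite [`|A|]/Num.Def.normr /= mx_normrE.
by apply/bigmax_leP; split=> // -[i j] _; exact: Ae.
Qed.

Lemma coord_le_mx_norm (R : realType) m n (A : 'M[R]_(m, n)) i j :
  `|A i j| <= `|A|.
Proof.
rewrite [`|A|]/Num.Def.normr /= mx_normrE.
by apply/bigmax_geP; right; exists (i, j).
Qed.

Lemma norm_mulmx_cV (R : realType) m n (A : 'M[R]_(m, n)) (h : 'cV[R]_n) :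
  `|A *m h| <= (\sum_i \sum_j `|A i j|) * `|h|.
Proof.
apply: mx_norm_le => [|i k].
  by rewrite mulr_ge0 // sumr_ge0 // => i _; rewrite sumr_ge0.
rewrite mxE (le_trans (ler_norm_sum _ _ _)) //.
apply: (@le_trans _ _ ((\sum_j `|A i j|) * `|h|)).
  rewrite mulr_suml ler_sum // => j _; rewrite normrM ler_wpM2l //.
  exact: coord_le_mx_norm.
rewrite ler_wpM2r // (bigD1 i) //= lerDl sumr_ge0 // => j _.
by rewrite sumr_ge0.
Qed.

Lemma norm_dot_le (R : realType) n (a h : 'cV[R]_n) :
  `|(a^T *m h) 0 0| <= (\sum_j `|a j 0|) * `|h|.
Proof.
rewrite mxE (le_trans (ler_norm_sum _ _ _)) // mulr_suml ler_sum // => j _.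
by rewrite mxE normrM ler_wpM2l // coord_le_mx_norm.
Qed.

(** Heine-Borel, carried from row vectors to column vectors by the continuous transposition. *)
Lemma bounded_closed_compact_cV (R : realType) n (A : set 'cV[R]_n) (M : R) :
  (forall v, A v -> `|v| <= M) -> closed A -> compact A.
Proof.
move=> AM Acl.
have trc p q : continuous (fun M : 'M[R]_(p, q) => M^T).
  move=> x; apply: (@cvg_mx _ _ (nbhs x) _ _ _ (fun M => M^T) x^T) => i j.
  rewrite mxE.
  under eq_fun do rewrite mxE.
  exact: coord_continuous.
have -> : A = (fun M : 'rV_n => M^T) @` ((fun M : 'rV_n => M^T) @^-1` A).
  rewrite eqEsubset; split=> v; last by case=> u /= Au <-.
  by move=> Av; exists v^T; rewrite /= ?trmxK.
apply: continuous_compact; first by apply: continuous_subspaceT; exact: trc.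
apply: bounded_closed_compact; last first.
  by apply: preimage_closed => // x _; exact: trc.
exists M; split; first exact: num_real.
move=> B MB v /= /AM vM; apply: le_trans (ltW MB).
apply: mx_norm_le => [|i j]; first exact: le_trans vM.
by apply: le_trans vM; have := coord_le_mx_norm v^T j i; rewrite mxE.
Qed.

Lemma is_diff_bound (R : realType) (V W : normedModType R) (f : V -> W)
    (df : {linear V -> W}) (x0 : V) : continuous df ->
  (forall e : R, 0 < e ->
    \forall x \near x0, `|f x - f x0 - df (x - x0)| <= e * `|x - x0|) ->
  is_diff x0 f df.
Proof.
move=> dfc H.
have dec : f \o shift x0 = cst (f x0) + df +o_ 0 id.
  apply/eqaddoP => e e0.
  have := H e e0; rewrite (near_shift 0) subr0; apply: filterS => h /=.
  by rewrite addrK !fctE /= opprD addrA.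
have dE : 'd f x0 = df :> (_ -> _) by apply: diff_unique.
apply: DiffDef; last exact: dE.
by apply/diff_locallyP; rewrite dE; split.
Qed.

(** Carathéodory's criterion: the remainder is [(A x - A0) *m (x - x0)], and its first factor tends
    to 0. *)
Lemma is_diff_caratheodory (R : realType) (p n : nat) (f : 'cV[R]_p -> 'cV[R]_n)
    (A : 'cV[R]_p -> 'M[R]_(n, p)) (x0 : 'cV[R]_p) (A0 : 'M[R]_(n, p)) :
  (\forall x \near x0, f x - f x0 = A x *m (x - x0)) ->
  A x @[x --> x0] --> A0 -> is_diff x0 f (mulmx A0).
Proof.
move=> fA AA0; apply: (@is_diff_bound _ 'cV[R]_p 'cV[R]_n f (mulmx A0)).
  move=> x; apply: (@cvg_mulmx _ _ (nbhs x) _ _ _ _ (fun=> A0) id A0 x).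
    exact: cvg_cst.
  by [].
move=> e e0.
have N0 : (\sum_(i < n) \sum_j `|(A x - A0) i j|) @[x --> x0] -->
    \sum_(i < n) \sum_(j < p) `|(A0 - A0) i j|.
  apply: (@cvg_sumr _ _ (nbhs x0)) => i; apply: (@cvg_sumr _ _ (nbhs x0)) => j.
  apply: cvg_norm; apply: (@cvg_coord _ _ _ _ _ _ (fun x => A x - A0)).
  by apply: cvgB => //; exact: cvg_cst.
near=> x; have -> : f x - f x0 = A x *m (x - x0) by near: x.
rewrite -mulmxBl (le_trans (norm_mulmx_cV _ _)) // ler_wpM2r // ltW //.
near: x; apply: (cvgr_lt _ N0); rewrite big1 // => i _.
by rewrite big1 // => j _; rewrite subrr mxE normr0.
Unshelve. all: by end_near. Qed.

(** * The barrier problem *)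

(* Unlike [mxE], these do not expand matrix products into sums. *)
Lemma addmxE (R : nmodType) m n (A B : 'M[R]_(m, n)) i j :
  (A + B) i j = A i j + B i j.
Proof. by rewrite mxE. Qed.

Lemma oppmxE (R : zmodType) m n (A : 'M[R]_(m, n)) i j : (- A) i j = - A i j.
Proof. by rewrite mxE. Qed.

Lemma scalemxE (R : pzSemiRingType) m n (a : R) (A : 'M[R]_(m, n)) i j :
  (a *: A) i j = a * A i j.
Proof. by rewrite mxE. Qed.

Lemma posdefmx_mxdiag (R : realType) (k : nat) (p : 'I_k -> nat)
    (Q : forall t, 'M[R]_(p t)) :
  (forall t, posdefmx (Q t)) -> posdefmx (\mxdiag_t Q t).
Proof.
move=> Qpd; split=> [|v v0].
  by rewrite tr_mxdiag; apply: eq_mxdiag => t; case: (Qpd t).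
have -> : v^T *m \mxdiag_t Q t *m v =
    \sum_t (submxcol v t)^T *m Q t *m submxcol v t.
  rewrite -{1 2}[v]submxcolK tr_mxcol -mulmxA mul_mxdiag_mxcol mul_mxrow_mxcol.
  by apply: eq_bigr => t _; rewrite mulmxA.
have [t vt] : exists t, submxcol v t != 0.
  apply: contrapT => nv; move/eqP: v0; apply; rewrite -[v]submxcolK.
  rewrite -mxcol0; apply: eq_mxcol => t.
  by apply/eqP/negPn/negP => vt; apply: nv; exists t.
rewrite summxE (bigD1 t) //= ltr_pwDl ?sumr_ge0 // => [|s _].
  by case: (Qpd t) => _; exact.
exact: posdefmx_ge0.
Qed.

Lemma mpcH_posdef (R : realType) (T dx du : nat) (D : mpc R T dx du) :
  (forall t, posdefmx (mpc_Q D t)) -> (forall t, posdefmx (mpc_R D t)) ->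
  posdefmx (mpcH D).
Proof.
move=> /posdefmx_mxdiag Qpd /posdefmx_mxdiag [RT R0]; split.
  rewrite /mpcH raddfD /= RT !trmx_mul trmxK mulmxA.
  by have [-> _] := Qpd.
move=> v v0; rewrite /mpcH mulmxDr mulmxDl mxE ltr_pwDl ?R0 //.
have -> : v^T *m ((Bhat D)^T *m Qblk D *m Bhat D) *m v =
    (Bhat D *m v)^T *m Qblk D *m (Bhat D *m v) by rewrite trmx_mul !mulmxA.
exact: posdefmx_ge0.
Qed.

(* Cauchy-Schwarz for the inner product defined by [H], between [v] and
   [H^-1 e_i]. *)
Lemma posdefmx_coord_le (R : realType) (n : nat) (H : 'M[R]_n)
    (v : 'cV[R]_n) i :
  posdefmx H -> v i 0 ^+ 2 <= invmx H i i * (v^T *m H *m v) 0 0.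
Proof.
move=> Hpd; have Hu := posdefmx_unit Hpd; have [HT _] := Hpd.
have HiT : (invmx H)^T = invmx H by rewrite trmx_inv HT.
set q := invmx H i i; set e : 'cV[R]_n := delta_mx i 0.
have ve : (v^T *m e) 0 0 = v i 0 by rewrite -colE !mxE.
have ev : (e^T *m v) 0 0 = v i 0 by rewrite trmx_delta -rowE !mxE.
have eq : (e^T *m invmx H *m e) 0 0 = q by rewrite -colE trmx_delta -rowE !mxE.
have q0 : 0 < q.
  rewrite -eq; apply: (proj2 (posdefmx_inv Hpd)); apply/eqP => /matrixP/(_ i 0).
  by rewrite !mxE !eqxx => /eqP; rewrite oner_eq0.
set s := v i 0 / q.
have := posdefmx_ge0 (v - s *: (invmx H *m e)) Hpd.
have -> : (v - s *: (invmx H *m e))^T *m H *m (v - s *: (invmx H *m e)) =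
    v^T *m H *m v - s *: (v^T *m e) - s *: (e^T *m v)
      + (s * s) *: (e^T *m invmx H *m e).
  have -> : (v - s *: (invmx H *m e))^T = v^T - s *: (e^T *m invmx H).
    by rewrite [LHS]linearB [X in _ - X]linearZ /= trmx_mul HiT.
  rewrite !(mulmxBl, mulmxBr) -!(scalemxAl, scalemxAr) !mulmxA.
  rewrite mulmxKV // mulmxK // scalerA opprB.
  by rewrite [X in _ + X]addrC addrA; congr (_ + _); exact: addrAC.
rewrite !(addmxE, oppmxE, scalemxE) ve ev eq.
rewrite /s; set a := v i 0.
have -> (y : R) :
    y - a / q * a - a / q * a + a / q * (a / q) * q = y - a ^+ 2 / q.
  by field; rewrite gt_eqF.
by rewrite subr_ge0 ler_pdivrMr // mulrC.
Qed.

Lemma mem_Sset (R : realType) (T dx du : nat) (D : mpc R T dx du) s :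
  (s \in Sset D) =
  (0 < \det (prinsub s (mpcG D *m invmx (mpcH D) *m (mpcG D)^T))).
Proof. by rewrite inE. Qed.

(** * Strong convexity of the barrier cost *)

Section Barrier.
Variables (R : realType) (T dx du : nat) (D : mpc R T dx du) (eta : R).
Hypothesis H_pd : posdefmx (mpcH D).
Hypothesis eta_gt0 : 0 < eta.
Implicit Types (x : 'cV[R]_dx) (u v h : 'cV[R]_(Udim T du)).

Definition inv_phi x u : 'cV[R]_(nconstr D) := \col_i (phi D x u i 0)^-1.

(** The gradient of [barrier_cost] in [u] in closed form. It enters through the convexity inequality
    below, so the cost itself is never differentiated. *)
Definition barrier_grad x u : 'cV[R]_(Udim T du) :=
  mpcH D *m u - (mpcF D)^T *m x + eta *: ((mpcG D)^T *m inv_phi x u)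
  + eta *: barrier_d D.

Lemma phiB x u v : phi D x u = phi D x v - mpcG D *m (u - v).
Proof. by rewrite /phi mulmxBr opprB addrA subrK. Qed.

(** For each constraint this is [ln y <= y - 1] at the ratio of the two slacks. *)
Lemma log_barrier_concave x u v :
  strictly_feasible D x u -> strictly_feasible D x v ->
  log_barrier D x u <=
    log_barrier D x v - (((mpcG D)^T *m inv_phi x v)^T *m (u - v)) 0 0.
Proof.
move=> su sv; rewrite trmx_mul trmxK -mulmxA mxE /log_barrier -sumrB.
apply: ler_sum => i _; rewrite [_^T 0 i]mxE [inv_phi _ _ _ _]mxE.
set a := phi D x u i 0; set b := phi D x v i 0.
have a0 : 0 < a := su i; have b0 : 0 < b := sv i.
have -> : (mpcG D *m (u - v)) i 0 = b - a.
  by rewrite /a (phiB x u v) addmxE oppmxE opprD opprK addrA subrr add0r.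
rewrite -lerBlDl -ln_div ?posrE // [b^-1 * _]mulrC.
have -> : a / b = 1 + (a / b - 1) by rewrite addrC subrK.
apply: (le_trans (le_ln1Dx _)); first by rewrite ltrBrDl subrr divr_gt0.
by rewrite mulrBl divff ?gt_eqF // opprB.
Qed.

(** The quadratic part expands exactly and yields the term in [H]; the logarithms contribute the
    concavity bound times [eta]. *)
Lemma barrier_cost_convex x u v :
  strictly_feasible D x u -> strictly_feasible D x v ->
  barrier_cost D eta x v + ((barrier_grad x v)^T *m (u - v)) 0 0
    + 2^-1 * ((u - v)^T *m mpcH D *m (u - v)) 0 0 <= barrier_cost D eta x u.
Proof.
move=> su sv; have [HT _] := H_pd.
have := log_barrier_concave su sv.
have [h ->] : exists h, u = v + h by exists (u - v); rewrite addrC subrK.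
rewrite [v + h]addrC addrK [h + v]addrC.
rewrite /barrier_grad /barrier_cost; move: HT.
move: (mpcH D) (mpcF D) => H F HT.
have -> : (H *m v - F^T *m x + eta *: ((mpcG D)^T *m inv_phi x v)
     + eta *: barrier_d D)^T =
   v^T *m H - x^T *m F + eta *: ((mpcG D)^T *m inv_phi x v)^T
     + eta *: (barrier_d D)^T.
  have trD (A B : 'cV[R]_(Udim T du)) : (A + B)^T = A^T + B^T by exact: linearD.
  have trZ a (A : 'cV[R]_(Udim T du)) : (a *: A)^T = a *: A^T by exact: linearZ.
  have trN (A : 'cV[R]_(Udim T du)) : (- A)^T = - A^T by exact: linearN.
  by rewrite !trD !trZ trN ![(_ *m _)^T]trmx_mul HT !trmxK.
have sym : (h^T *m H *m v) 0 0 = (v^T *m H *m h) 0 0.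
  have -> : h^T *m H *m v = (v^T *m H *m h)^T.
    by rewrite !trmx_mul trmxK HT mulmxA.
  by rewrite [LHS]mxE.
have -> : (v + h)^T = v^T + h^T by rewrite raddfD.
rewrite !(mulmxDl, mulmxDr) !mulNmx -!scalemxAl !(addmxE, oppmxE, scalemxE) sym.
move/(ler_wpM2l (ltW eta_gt0)).
set q1 := (v^T *m H *m v) 0 0; set q2 := (v^T *m H *m h) 0 0.
set q3 := (h^T *m H *m h) 0 0.
move: (log_barrier _ _ (v + h)) (log_barrier _ _ v) => lu lv.
move: ((_ *m h) 0 0) => p.
lra.
Qed.

Lemma posdefmx_norm_le (h : 'cV[R]_(Udim T du)) :
  `|h| ^+ 2 <= (\sum_i `|invmx (mpcH D) i i|) * (h^T *m mpcH D *m h) 0 0.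
Proof.
have [->|h0] := eqVneq h 0.
  by rewrite normr0 expr0n /= mulmx0 mxE mulr0.
have [[i j] /= hij] : exists i : 'I_(Udim T du) * 'I_1, `|h| = `|h i.1 i.2|.
  by apply: mx_norm_neq0; move: h0; rewrite -normr_eq0.
rewrite hij (ord1 j) real_normK ?num_real //.
apply: (le_trans (posdefmx_coord_le _ i H_pd)); apply: ler_wpM2r.
  exact: posdefmx_ge0.
rewrite (bigD1 i) //= (le_trans (ler_norm _)) // lerDl sumr_ge0 //.
Qed.

Lemma barrier_sublevel_le x u v :
  strictly_feasible D x u -> strictly_feasible D x v ->
  barrier_cost D eta x u <= barrier_cost D eta x v ->
  `|u - v| <= 2 * (\sum_i `|invmx (mpcH D) i i|) *
              \sum_j `|barrier_grad x v j 0|.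
Proof.
move=> su sv uv; have := barrier_cost_convex su sv.
move: (norm_dot_le (barrier_grad x v) (u - v)) (posdefmx_norm_le (u - v)).
set g := (_ *m (u - v)) 0 0; set q := (_ *m _ *m (u - v)) 0 0.
set N := \sum_j _; set C := \sum_i _ => gN Cq cvx.
have C0 : 0 <= C by apply: sumr_ge0.
have N0 : 0 <= N by apply: sumr_ge0.
(* Convexity gives [q / 2 <= - g <= N * |u - v|], while [|u - v| ^ 2 <= C * q]; it remains to divide
   by [|u - v|]. *)
have [->|d0] := eqVneq `|u - v| 0; first by rewrite !mulr_ge0.
have d1 : 0 < `|u - v| by rewrite lt_def d0 normr_ge0.
rewrite -(ler_pM2r d1) -expr2 (le_trans Cq) //.
rewrite -[2 * C]mulrC -!mulrA ler_wpM2l //.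
have := ler_norm (- g); rewrite normrN; lra.
Qed.

(** * Continuity of the barrier terms along a filter *)

Section Limits.
Variables (S : Type) (F : set_system S).
Context {FF : Filter F}.
Variables (f : S -> 'cV[R]_dx) (g : S -> 'cV[R]_(Udim T du)).
Variables (x : 'cV[R]_dx) (u : 'cV[R]_(Udim T du)).
Hypothesis (fx : f @ F --> x) (gu : g @ F --> u).

Let cst_mul_cvg m n (A : 'M[R]_(m, n)) (k : S -> 'cV[R]_n) (y : 'cV[R]_n) :
  k @ F --> y -> (fun t => A *m k t) @ F --> A *m y.
Proof. by move=> ky; apply: cvg_mulmx => //; exact: cvg_cst. Qed.

Lemma phi_cvg : (fun t => phi D (f t) (g t)) @ F --> phi D x u.
Proof.
apply: cvgB; last exact: cst_mul_cvg.
by apply: cvgD; [exact: cst_mul_cvg|exact: cvg_cst].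
Qed.

Lemma strictly_feasible_near : strictly_feasible D x u ->
  \forall t \near F, strictly_feasible D (f t) (g t).
Proof.
move=> su; apply: filter_forall => i.
exact: (cvgr_gt _ (cvg_coord (i := i) (j := 0) phi_cvg) _ (su i)).
Qed.

Lemma barrier_grad_cvg : strictly_feasible D x u ->
  (fun t => barrier_grad (f t) (g t)) @ F --> barrier_grad x u.
Proof.
move=> su; apply: cvgD; last exact: cvg_cst.
apply: cvgD; first by apply: cvgB; exact: cst_mul_cvg.
apply: cvgZl_tmp; apply: cst_mul_cvg; apply: cvg_mx => i j; rewrite mxE.
rewrite (_ : (fun t => _) = fun t => (phi D (f t) (g t) i 0)^-1); last first.
  by apply/funext => t; rewrite mxE.
by apply: cvgV; [rewrite gt_eqF|apply: (cvg_coord phi_cvg)].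
Qed.

Lemma barrier_cost_cvg : strictly_feasible D x u ->
  (fun t => barrier_cost D eta x (g t)) @ F --> barrier_cost D eta x u.
Proof.
move=> su.
have trg : (fun t => (g t)^T) @ F --> u^T.
  apply: cvg_mx => i j; rewrite mxE; under eq_fun do rewrite mxE.
  exact: cvg_coord.
apply: cvgB.
  apply: cvgB; last by apply: cvg_coord; exact: cst_mul_cvg.
  apply: cvgMl_tmp; apply: (cvg_coord (f := fun t => (g t)^T *m mpcH D *m g t)).
  by apply: cvg_mulmx => //; apply: cvg_mulmx => //; exact: cvg_cst.
apply: cvgMl_tmp; apply: cvgB; last by apply: cvg_coord; exact: cst_mul_cvg.
apply: cvg_sumr => i.
have c : (fun t => phi D x (g t) i 0) @ F --> phi D x u i 0.
  apply: (cvg_coord (f := fun t => phi D x (g t))).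
  by apply: cvgB; [exact: cvg_cst|exact: cst_mul_cvg].
by apply: (cvg_comp _ _ c); exact: continuous_ln (su i).
Qed.

End Limits.

(** * Existence, stationarity and continuity of the minimizer *)

Lemma barrier_argmin_exists x v :
  strictly_feasible D x v -> barrier_argmin D eta x !=set0.
Proof.
move=> sv.
(* The sublevel set of [v] has radius at most [rho] about [v]. On it [Bq] bounds the linear term and
   [M] every slack, hence every logarithm. A cost at most that of [v] bounds the sum of logarithms
   below, so no slack is under [delta], and the compact set [K] stays off the boundary. *)
pose rho := 2 * (\sum_i `|invmx (mpcH D) i i|) * \sum_j `|barrier_grad x v j 0|.
pose q := (mpcF D)^T *m x - eta *: barrier_d D.
pose Bq := (\sum_j `|q j 0|) * (`|v| + rho).
pose M := \sum_i phi D x v i 0 + (\sum_i \sum_j `|mpcG D i j|) * rho.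
pose delta :=
  expR ((- Bq - barrier_cost D eta x v) / eta - \sum_(i < nconstr D) M).
pose K : set 'cV[R]_(Udim T du) := [set u | `|u - v| <= rho] `&`
  \bigcap_(i in [set: 'I_(nconstr D)]) [set u | delta <= phi D x u i 0].
have rho0 : 0 <= rho.
  by rewrite /rho mulr_ge0 // ?mulr_ge0 // sumr_ge0.
have subK u : strictly_feasible D x u ->
    barrier_cost D eta x u <= barrier_cost D eta x v -> K u.
  move=> su uv; have uv_rho := barrier_sublevel_le su sv uv.
  have phiM i : phi D x u i 0 <= M.
    rewrite (phiB x u v) addmxE oppmxE /M lerD //.
      by rewrite (bigD1 i) //= lerDl sumr_ge0 // => j _; exact/ltW/sv.
    rewrite (le_trans (ler_norm _)) // normrN.
    rewrite (le_trans (coord_le_mx_norm _ _ _)) //.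
    rewrite (le_trans (norm_mulmx_cV _ _)) // ler_wpM2l //.
    by rewrite sumr_ge0 // => k _; rewrite sumr_ge0.
  have logge : (- Bq - barrier_cost D eta x v) / eta <= log_barrier D x u.
    rewrite ler_pdivrMr //.
    have qu : `|(q^T *m u) 0 0| <= Bq.
      rewrite (le_trans (norm_dot_le _ _)) // ler_wpM2l ?sumr_ge0 //.
      have -> : u = v + (u - v) by rewrite addrC subrK.
      by rewrite (le_trans (ler_normD _ _)) // lerD2l.
    have qE : (q^T *m u) 0 0 =
        (x^T *m mpcF D *m u) 0 0 - eta * ((barrier_d D)^T *m u) 0 0.
      have -> : q^T = x^T *m mpcF D - eta *: (barrier_d D)^T.
        by rewrite /q [LHS]linearB [X in _ - X]linearZ /= trmx_mul trmxK.
      by rewrite mulmxBl -scalemxAl addmxE oppmxE scalemxE.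
    have := posdefmx_ge0 u H_pd; have := ler_norm ((q^T *m u) 0 0).
    move: uv; rewrite {1}/barrier_cost; lra.
  split=> [//|i _ /=].
  rewrite -[leRHS]lnK ?posrE ?su // ler_expR.
  have : log_barrier D x u <= ln (phi D x u i 0) + \sum_(i < nconstr D) M.
    (* The sum of [M] also counts the index [i], which is harmless because [M] is nonnegative. *)
    have M0 : 0 <= M by apply: le_trans (phiM i); exact/ltW/su.
    rewrite /log_barrier (bigD1 i) //= lerD2l.
    rewrite [leRHS](bigD1 i) //= -[leLHS]add0r lerD // ler_sum // => j _.
    by rewrite (le_trans _ (phiM j)) // ltW // ln_sublinear.
  lra.
have Kclosed : closed K.
  apply: closedI.
    apply: (@preimage_closed _ _ (fun u => `|u - v|) [set y | y <= rho]).
      move=> u _; apply: (@cvg_norm _ _ _ (nbhs u)).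
      by apply: (@cvgB _ _ _ (nbhs u)) => //; exact: cvg_cst.
    exact: closed_le.
  apply: closed_bigI => i _.
  apply: (@preimage_closed _ _ (fun u => phi D x u i 0) [set y | delta <= y]).
    move=> u _; apply: (@cvg_coord _ _ (nbhs u) _ _ _ (fun u => phi D x u)).
    by apply: (@phi_cvg _ (nbhs u)) => //; exact: cvg_cst.
  exact: closed_ge.
have Kcompact : compact K.
  apply: (@bounded_closed_compact_cV _ _ _ (`|v| + rho)) => // u [uv _].
  have -> : u = v + (u - v) by rewrite addrC subrK.
  by rewrite (le_trans (ler_normD _ _)) // lerD2l.
have Kv : K v by exact: subK.
have Ksf u : K u -> strictly_feasible D x u.
  by move=> [_ Ku] i; apply: lt_le_trans (Ku i I); exact: expR_gt0.
have Kn0 : K !=set0 by exists v.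
have Kcont : {within K, continuous (barrier_cost D eta x)}.
  apply: continuous_in_subspaceT => u /set_mem/Ksf su.
  exact: (@barrier_cost_cvg _ (nbhs u)).
have [u0 Ku0 u0min] := compact_EVT_min Kn0 Kcompact Kcont.
exists u0; split; first by apply: Ksf; exact: set_mem.
move=> w sw.
(* Points outside the sublevel set of [v] already cost more than [v], which lies in [K]. *)
have [wv|/ltW vw] := leP (barrier_cost D eta x w) (barrier_cost D eta x v).
  by apply/u0min/mem_set/subK.
by apply: le_trans vw; exact/u0min/mem_set.
Qed.

(** Convexity based at [u + t *: h] and minimality of [u] give a nonnegative slope along [h] at
    [u + t *: h] for small [t > 0]; let [t] tend to 0. *)
Lemma barrier_argmin_grad x u :
  barrier_argmin D eta x u -> barrier_grad x u = 0.
Proof.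
move=> [su umin].
suff ge0 h : 0 <= ((barrier_grad x u)^T *m h) 0 0.
  (* The direction opposite to the gradient makes minus its squared length nonnegative. *)
  have := ge0 (- barrier_grad x u); rewrite mulmxN oppmxE oppr_ge0.
  set g := barrier_grad x u => gg.
  apply/matrixP => i j; rewrite (ord1 j) [RHS]mxE; apply/eqP.
  rewrite -sqrf_eq0 eq_le sqr_ge0 andbT; apply: le_trans gg.
  rewrite [leRHS]mxE (bigD1 i) //= [g^T 0 i]mxE -expr2 lerDl sumr_ge0 // => k _.
  by rewrite mxE -expr2 sqr_ge0.
have uh : u + t *: h @[t --> 0^'+] --> u.
  rewrite -[X in _ --> X]addr0; apply: cvgD; first exact: cvg_cst.
  rewrite -(scale0r h); apply: cvgZr_tmp.
  by apply: cvg_at_right_filter.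
have xx : x @[t --> (0 : R)^'+] --> x by exact: cvg_cst.
have gc : ((barrier_grad x (u + t *: h))^T *m h) 0 0 @[t --> 0^'+] -->
    ((barrier_grad x u)^T *m h) 0 0.
  have trc : (barrier_grad x (u + t *: h))^T @[t --> 0^'+] -->
      (barrier_grad x u)^T.
    apply: cvg_mx => i j; rewrite mxE; under eq_fun do rewrite mxE.
    by apply: cvg_coord; exact: barrier_grad_cvg.
  apply: (cvg_coord (f := fun t => (barrier_grad x (u + t *: h))^T *m h)).
  by apply: cvg_mulmx => //; exact: cvg_cst.
apply: (cvgr_to_ge gc); near=> t.
have t0 : 0 < t by near: t; exact: nbhs_right_gt.
have sth : strictly_feasible D x (u + t *: h).
  by near: t; exact: (strictly_feasible_near xx uh).
have := barrier_cost_convex su sth; have := umin _ sth.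
have := posdefmx_ge0 (u - (u + t *: h)) H_pd.
have -> : u - (u + t *: h) = - t *: h.
  by rewrite opprD addrA subrr add0r scaleNr.
rewrite -[in X in _ -> _ -> X <= _ -> _]scalemxAr !scalemxE.
set q := (_ *m mpcH D *m _) 0 0 => q0 le1 le2.
rewrite -(pmulr_rge0 _ t0); lra.
Unshelve. all: by end_near. Qed.

Lemma u_etaP x :
  strictly_feasible D x !=set0 -> barrier_argmin D eta x (u_eta D eta x).
Proof. by case=> v /barrier_argmin_exists; exact: xgetPex. Qed.

Lemma u_eta_cvg x0 : strictly_feasible D x0 !=set0 ->
  u_eta D eta x @[x --> x0] --> u_eta D eta x0.
Proof.
move=> /u_etaP u0min; have [su0 _] := u0min.
set u0 := u_eta D eta x0 in u0min su0 *.
have xx : x @[x --> x0] --> x0 by [].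
have uu : (fun _ : 'cV[R]_dx => u0) @ x0 --> u0.
  exact: (@cvg_cst _ _ _ (nbhs x0)).
set C := 2 * \sum_i `|invmx (mpcH D) i i|.
have gc : (C * \sum_j `|barrier_grad x u0 j 0|) @[x --> x0] -->
    C * \sum_j `|barrier_grad x0 u0 j 0|.
  apply: (@cvgMl_tmp _ _ (nbhs x0)); apply: (@cvg_sumr _ _ (nbhs x0)) => j.
  apply: (@cvg_norm _ _ _ (nbhs x0)).
  apply: (@cvg_coord _ _ (nbhs x0) _ _ _ (fun x => barrier_grad x u0)).
  exact: (@barrier_grad_cvg _ (nbhs x0) _ _ _ _ _ xx uu).
apply/(@cvgrPdist_lt _ _ _ (nbhs x0)) => e e0.
(* The gradient vanishes at the minimizer [u0] for [x0], so the bound tends to 0. *)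
have gx0 : C * \sum_j `|barrier_grad x0 u0 j 0| < e.
  rewrite [X in _ * X]big1 ?mulr0 // => j _.
  by rewrite (barrier_argmin_grad u0min) mxE normr0.
near=> x.
have sx : strictly_feasible D x u0.
  by near: x; exact: (strictly_feasible_near xx uu su0).
have gx : C * \sum_j `|barrier_grad x u0 j 0| < e.
  by near: x; exact: (cvgr_lt _ gc _ gx0).
have [sux uxmin] : barrier_argmin D eta x (u_eta D eta x).
  by apply: u_etaP; exists u0.
rewrite distrC (le_lt_trans _ gx) //.
exact: barrier_sublevel_le sux sx (uxmin _ sx).
Unshelve. all: by end_near. Qed.

(* Subtracting the stationarity conditions at [x] and [x0] gives an exact
   linear relation between the increments of [x] and of the minimizer. *)
Lemma u_eta_increment x x0 :
  strictly_feasible D x !=set0 -> strictly_feasible D x0 !=set0 ->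
  let l := \row_i (eta^-1 * (phi D x (u_eta D eta x) i 0
                             * phi D x0 (u_eta D eta x0) i 0)) in
  let w := minor_weight (invmx (mpcH D)) (mpcG D) l in
  u_eta D eta x - u_eta D eta x0 =
  ((\sum_(s in Sset D) w s)^-1 *: \sum_(s in Sset D) w s *: K_sigma D s)
    *m (x - x0).
Proof.
move=> /u_etaP umin /u_etaP u0min l w.
set u := u_eta D eta x in umin l w *; set u0 := u_eta D eta x0 in u0min l w *.
clearbody u u0; have [su _] := umin; have [su0 _] := u0min.
have l0 i : 0 < l 0 i by rewrite mxE mulr_gt0 ?invr_gt0 // mulr_gt0.
rewrite !(eq_bigl _ _ (@mem_Sset _ _ _ _ D)).
apply: (kkt_solve (z := eta *: (inv_phi x u - inv_phi x0 u0)) H_pd l0).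
  have := etrans (barrier_argmin_grad umin) (esym (barrier_argmin_grad u0min)).
  rewrite /barrier_grad => /addIr.
  rewrite -scalemxAr; move: (mpcG D)^T (mpcF D)^T (mpcH D) => Gt Ft H.
  rewrite !mulmxBr scalerBr.
  move: (H *m u) (H *m u0) (Ft *m x) (Ft *m x0) (eta *: _) (eta *: _).
  move=> a b c d p q e.
  apply/matrixP => i j; have := congr1 (fun N : 'cV_ _ => N i j) e.
  rewrite !(addmxE, oppmxE); lra.
apply/matrixP => i j; rewrite (ord1 j) mul_diag_mx [LHS]mxE.
rewrite scalemxE !(addmxE, oppmxE) [inv_phi x u _ _]mxE [inv_phi x0 u0 _ _]mxE.
(* Complementarity is [1/a - 1/b = (b - a) / (a b)] for the slacks [a] and [b]; the weight [l]
   clears this denominator and [eta]. *)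
have -> : (mpcG D *m (u - u0)) i 0 - (mpcP D *m (x - x0)) i 0 =
    phi D x0 u0 i 0 - phi D x u i 0.
  rewrite /phi; move: (mpcG D) (mpcP D) => G P.
  rewrite !mulmxBr !(addmxE, oppmxE); ring.
rewrite [l _ _]mxE; move: (su i) (su0 i).
move: (phi D x u i 0) (phi D x0 u0 i 0) => a b a0 b0.
by field; rewrite !gt_eqF.
Qed.

End Barrier.

(** * Limit of the weights and the derivative at [x0] *)

Lemma minor_weight_cvg (R : realType) (m n : nat) (K : 'M[R]_n)
    (G : 'M[R]_(m, n)) (S : Type) (F : set_system S) {FF : Filter F}
    (l : S -> 'rV[R]_m) (a : 'rV[R]_m) s :
  (forall i, (fun t => l t 0 i) @ F --> a 0 i) ->
  (fun t => minor_weight K G (l t) s) @ F --> minor_weight K G a s.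
Proof.
move=> la; apply: cvgMl_tmp.
apply: cvg_big => [|i _]; first exact: mul_continuous.
apply: (@cvg_comp _ _ _ (fun t => l t 0 i) (fun y => y ^+ (1 - s i)%N)).
  exact: la.
exact: exprn_continuous.
Qed.

Theorem lemma4p6 (R : realType) (T dx du : nat) (D : mpc R T dx du)
  (eta : R) (x0 : 'cV[R]_dx)
  (T_ge1 : (1 <= T)%N)
  (Q_posdef : forall t, posdefmx (mpc_Q D t))
  (R_posdef : forall t, posdefmx (mpc_R D t))
  (X_compact : forall t, compact (polyhedron (mpc_Cx D t) (mpc_bx D t)))
  (U_compact : forall t, compact (polyhedron (mpc_Cu D t) (mpc_bu D t)))
  (w_gt0 : forall i, 0 < mpcw D i 0)
  (eta_gt0 : 0 < eta)
  (K_ball : exists (c : 'cV[R]_(Udim T du)) (r : R),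
     0 < r /\ ball c r `<=` feasible D x0)
  (K_bounded : bounded_set (feasible D x0))
  (dom_x0 : strictly_feasible D x0 !=set0) :
  is_diff x0 (u_eta D eta)
    (mulmx ((\sum_(s in Sset D) h_sigma D eta x0 s)^-1 *:
            \sum_(s in Sset D) h_sigma D eta x0 s *: K_sigma D s)).
Proof.
have H_pd := mpcH_posdef Q_posdef R_posdef.
have [su0 _] := u_etaP H_pd eta_gt0 dom_x0.
have xx : x @[x --> x0] --> x0 by [].
have uc := u_eta_cvg H_pd eta_gt0 dom_x0.
pose l x : 'rV[R]_(nconstr D) := \row_i (eta^-1 * (phi D x (u_eta D eta x) i 0
                             * phi D x0 (u_eta D eta x0) i 0)).
pose w x := minor_weight (invmx (mpcH D)) (mpcG D) (l x).
have wE s : h_sigma D eta x0 s = w x0 s.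
  by congr (_ * _); apply: eq_bigr => i _; rewrite [l x0 0 i]mxE expr2.
under eq_bigr do rewrite wE.
under [X in _ *: X]eq_bigr do rewrite wE.
have sumw_gt0 : 0 < \sum_(s in Sset D) w x0 s.
  rewrite (eq_bigl _ _ (@mem_Sset _ _ _ _ D)).
  apply: minor_weight_sum_gt0 => [|i]; first exact: posdefmx_inv.
  by rewrite [l x0 0 i]mxE mulr_gt0 ?invr_gt0 // mulr_gt0.
have wc s : w x s @[x --> x0] --> w x0 s.
  apply: (@minor_weight_cvg _ _ _ _ _ _ (nbhs x0)) => i.
  rewrite mxE; under eq_fun do rewrite mxE.
  apply: (@cvgMl_tmp _ _ (nbhs x0)); apply: (@cvgMr_tmp _ _ (nbhs x0)).
  apply: (@cvg_coord _ _ (nbhs x0) _ _ _ (fun x => phi D x (u_eta D eta x))).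
  exact: (@phi_cvg _ _ _ _ _ _ (nbhs x0)).
(* The weighted mean at [x] is the exact slope between [x0] and [x]; only its weights vary with
   [x]. *)
apply: (@is_diff_caratheodory _ _ _ _
    (fun x => (\sum_(s in Sset D) w x s)^-1 *:
              \sum_(s in Sset D) w x s *: K_sigma D s)); last first.
  exact: (@cvg_weighted_mean R _ (nbhs x0) _ _ (index_enum _)
    (fun s => s \in Sset D) _ _ w (w x0) (K_sigma D) wc (lt0r_neq0 sumw_gt0)).
(* The minimizer for [x0] remains strictly feasible at nearby [x], so a minimizer exists there
   too. *)
near=> x; apply: u_eta_increment => //; exists (u_eta D eta x0).
near: x; apply: (strictly_feasible_near xx _ su0).
exact: (@cvg_cst _ _ _ (nbhs x0)).
Unshelve. all: by end_near. Qed.
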